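(* Let $\mathbb K$ be a d-minimal first-order topological structure and let $\mathbb M\succeq\mathbb K$ be a monster model of the theory of $\mathbb K$. For $A\subset\mathbb M$ and $b\in\mathbb M$, let $b\in\mathrm{Zcl}(A)$ iff there is an $A$-definable set $X\subset\mathbb M$ with empty interior such that $b\in X$. Then $\mathrm{Zcl}$ is an existential matroid on $\mathbb M$.
   Context: A first-order topological structure is a structure $\mathbb K$ with a topology having as a basis the family $\{\Phi(\mathbb K,\bar a):\bar a\in\mathbb K^m\}$ for some fixed formula $\Phi(x,\bar y)$ without parameters; $\mathbb K^n$ carries the product topology, and elementary extensions of $\mathbb K$ are topologized using the same $\Phi$. ''Definable'' means definable with parameters. Let $\mathbb M\succeq\mathbb K$ be a monster model ($\kappa$-saturated, strongly $\kappa$-homogeneous, $\kappa$ large); ''small'' means of cardinality $<\kappa$. $\mathbb K$ is d-minimal if: 1. points of $\mathbb K$ are closed ($\mathbb K$ is $T_1$); 2. $\mathbb K$ has no isolated points; 3. every definable $X\subseteq\mathbb M$ (parameters in $\mathbb M$) with empty interior is a finite union of discrete sets; 4. for every definable discrete $X\subset\mathbb K^n$, the projection of $X$ onto the first coordinate has empty interior; 5. given definable $X\subseteq\mathbb K^2$ and $U\subseteq\Pi^2_1(X)$ (where $\Pi^2_1$ is the projection onto the first coordinate), if $U$ is open and non-empty and $X_a=\{t:(a,t)\in X\}$ has non-empty interior for every $a\in U$, then $X$ has non-empty interior. A (finitary) matroid on $\mathbb M$ is an operator $\mathrm{cl}:\mathcal P(\mathbb M)\to\mathcal P(\mathbb M)$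 with: $X\subseteq \mathrm{cl}(X)$; $X\subseteq Y\Rightarrow \mathrm{cl}(X)\subseteq \mathrm{cl}(Y)$; $\mathrm{cl}(\mathrm{cl}(X))=\mathrm{cl}(X)$; $\mathrm{cl}(X)=\bigcup\{\mathrm{cl}(A): A\subseteq X \text{ finite}\}$; and exchange: $a\in \mathrm{cl}(X\cup\{c\})\setminus \mathrm{cl}(X)$ implies $c\in\mathrm{cl}(X\cup\{a\})$. A formula $\phi(x,\bar y)$ without parameters, $x$ a single variable, is $x$-narrow if for all $a,\bar b$, $\mathbb M\models\phi(a,\bar b)$ implies $a\in\mathrm{cl}(\bar b)$. The matroid is definable if for every $A$, $\mathrm{cl}(A)$ is the union of the sets $\phi(\mathbb M,\bar a)$ with $\phi$ $x$-narrow and $\bar a$ a finite tuple from $A$. It satisfies Existence if for every element $a$ and all small $B,C$ with $a\notin\mathrm{cl}(B)$ there is $a'$ with the same type as $a$ over $B$ and $a'\notin\mathrm{cl}(B\cup C)$. The trivial matroid is $\mathrm{cl}^0(X)=\mathbb M$ for all $X$. An existential matroid is a definable matroid that satisfies Existence and is not trivial. *)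

(* Defs.v *)
From mathcomp Require Import all_boot boolp classical_sets functions.
From mathcomp Require Import cardinality topology.

Set Implicit Arguments.
Unset Strict Implicit.
Unset Printing Implicit Defensive.

Local Open Scope classical_set_scope.

Definition fcat (T : Type) (m n : nat) (u : 'I_m -> T) (v : 'I_n -> T) :
    'I_(m + n) -> T :=
  fun i => match fintype.split i with inl j => u j | inr j => v j end.

Definition scons (T : Type) (n : nat) (x : T) (v : 'I_n -> T) : 'I_n.+1 -> T :=
  fcat (fun _ : 'I_1 => x) v.

(** First-order logic. [formula L n] has its free variables among ['I_n];
    a quantifier binds variable [0], shifting the others by one. *)

Record language := Language {
  fsym : Type;
  farity : fsym -> nat;
  rsym : Type;
  rarity : rsym -> nat
}.

Inductive term (L : language) (n : nat) : Type :=
| Var (i : 'I_n)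
| App (f : fsym L) (args : 'I_(farity f) -> term L n).
Arguments App {L n} f args.

Inductive formula (L : language) : nat -> Type :=
| Bot (n : nat) : formula L n
| Eq (n : nat) (s t : term L n) : formula L n
| Rel (n : nat) (r : rsym L) (args : 'I_(rarity r) -> term L n) : formula L n
| Imp (n : nat) (phi psi : formula L n) : formula L n
| All (n : nat) (phi : formula L n.+1) : formula L n.
Arguments Rel {L n} r args.

Record structure (L : language) (M : Type) := Structure {
  fint : forall f : fsym L, ('I_(farity f) -> M) -> M;
  rint : forall r : rsym L, ('I_(rarity r) -> M) -> Prop;
  carrier_inhabited : inhabited M
}.
Arguments fint {L M} S f v : rename.
Arguments rint {L M} S r v : rename.

Fixpoint eval (L : language) (M : Type) (S : structure L M) (n : nat)
    (v : 'I_n -> M) (t : term L n) : M :=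
  match t with
  | Var i => v i
  | App f args => fint S f (fun i => eval S v (args i))
  end.

Fixpoint sat (L : language) (M : Type) (S : structure L M) (n : nat)
    (phi : formula L n) : ('I_n -> M) -> Prop :=
  match phi with
  | Bot _ => fun _ => False
  | Eq _ s t => fun v => eval S v s = eval S v t
  | Rel _ r args => fun v => rint S r (fun i => eval S v (args i))
  | Imp _ phi psi => fun v => sat S phi v -> sat S psi v
  | All _ phi => fun v => forall x : M, sat S phi (scons x v)
  end.

Definition elementary_embedding (L : language) (K M : Type)
    (SK : structure L K) (SM : structure L M) (f : K -> M) : Prop :=
  forall (n : nat) (phi : formula L n) (v : 'I_n -> K),
    sat SK phi v <-> sat SM phi (f \o v).

Definition automorphism (L : language) (M : Type) (S : structure L M)
    (g : M -> M) : Prop :=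
  [/\ bijective g,
      forall (f : fsym L) (v : 'I_(farity f) -> M),
        g (fint S f v) = fint S f (g \o v)
    & forall (r : rsym L) (v : 'I_(rarity r) -> M),
        rint S r v <-> rint S r (g \o v)].

(** Formulas in the variables [0, ..., n - 1] with parameters in [M]: the
    variables of [lform] from [n] on are interpreted by [param]. *)
Record lformula (L : language) (M : Type) (n : nat) := LFormula {
  nparam : nat;
  lform : formula L (n + nparam);
  param : 'I_nparam -> M
}.
Arguments param {L M n} psi _ : rename.

Section Structure.
Context {L : language} {M : Type} (S : structure L M).

Definition holds (n : nat) (v : 'I_n -> M) (psi : lformula L M n) : Prop :=
  sat S (lform psi) (fcat v (param psi)).

Definition over (A : set M) (n : nat) (psi : lformula L M n) : Prop :=
  forall i, A (param psi i).

Definition definable_over (A : set M) (n : nat) (X : set ('I_n -> M)) : Prop :=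
  exists psi : lformula L M n, over A psi /\ X = [set v | holds v psi].

Definition holds1 (x : M) (psi : lformula L M 1) : Prop :=
  holds (fun _ : 'I_1 => x) psi.

Definition definable1_over (A : set M) (X : set M) : Prop :=
  exists psi : lformula L M 1, over A psi /\ X = [set x | holds1 x psi].

Definition same_type (B : set M) (a a' : M) : Prop :=
  forall psi : lformula L M 1, over B psi -> holds1 a psi <-> holds1 a' psi.

Definition finitely_satisfiable (p : set (lformula L M 1)) : Prop :=
  forall q, q `<=` p -> finite_set q ->
    exists x, forall psi, q psi -> holds1 x psi.

(** [phi(M, a)], for [phi(x, y)] with [x] the variable [0] *)
Definition solutions (m : nat) (phi : formula L m.+1) (a : 'I_m -> M) : set M :=
  [set x | sat S phi (scons x a)].

End Structure.

(** Cardinals are represented by types: [|A| < |kappa|] *)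
Definition small (kappa T : Type) (A : set T) : Prop :=
  (A #<= [set: kappa])%card /\ ~ ([set: kappa] #<= A)%card.

Definition saturated (kappa : Type) (L : language) (M : Type)
    (S : structure L M) : Prop :=
  forall (A : set M) (p : set (lformula L M 1)),
    small kappa A -> p `<=` over A (n := 1) -> finitely_satisfiable S p ->
    exists x, forall psi, p psi -> holds1 S x psi.

Definition partial_elementary (L : language) (M : Type) (S : structure L M)
    (A : set M) (h : M -> M) : Prop :=
  forall (n : nat) (phi : formula L n) (v : 'I_n -> M),
    (forall i, A (v i)) -> sat S phi v <-> sat S phi (h \o v).

Definition strongly_homogeneous (kappa : Type) (L : language) (M : Type)
    (S : structure L M) : Prop :=
  forall (A : set M) (h : M -> M),
    small kappa A -> partial_elementary S A h ->
    exists2 g : M -> M, automorphism S g & forall x, A x -> g x = h x.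

(** The fields [small_*] are the meaning of "kappa is large":
    [kappa > aleph_0 + |L| + |K|]. *)
Record monster_model (kappa : Type) (L : language) (K M : Type)
    (SK : structure L K) (SM : structure L M) (f : K -> M) : Prop := {
  monster_elementary : elementary_embedding SK SM f;
  monster_saturated : saturated kappa SM;
  monster_homogeneous : strongly_homogeneous kappa SM;
  small_nat : small kappa [set: nat];
  small_fsym : small kappa [set: fsym L];
  small_rsym : small kappa [set: rsym L];
  small_submodel : small kappa [set: K]
}.

Definition topologized_by (L : language) (T : topologicalType)
    (S : structure L T) (m : nat) (Phi : formula L m.+1) : Prop :=
  basis [set solutions S Phi a | a in [set: 'I_m -> T]].

Definition discrete_subset (T : topologicalType) (X : set T) : Prop :=
  forall x, X x -> isolated X x.

Definition finite_union_discrete (T : topologicalType) (X : set T) : Prop :=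
  exists (N : nat) (D : 'I_N -> set T),
    (forall i, discrete_subset (D i)) /\ X = \bigcup_i D i.

Definition proj1st (T : Type) (n : nat) (X : set ('I_n.+1 -> T)) : set T :=
  [set v ord0 | v in X].

Definition fiber (T : Type) (X : set ('I_2 -> T)) (a : T) : set T :=
  [set t | X (scons a (fun _ : 'I_1 => t))].

(** [{ptws 'I_n -> K}] is the power [K^n] with the product topology. *)
Record d_minimal (L : language) (K M : topologicalType)
    (SK : structure L K) (SM : structure L M) : Prop := {
  dmin_T1 : forall x : K, closed [set x];
  dmin_no_isolated : forall x : K, ~ isolated [set: K] x;
  dmin_empty_interior : forall X : set M,
    definable1_over SM setT X -> interior X = set0 -> finite_union_discrete X;
  dmin_projection : forall (n : nat) (X : set {ptws 'I_n.+1 -> K}),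
    definable_over SK setT X -> discrete_subset X ->
    interior (proj1st X) = set0;
  dmin_fibers : forall (X : set {ptws 'I_2 -> K}) (U : set K),
    definable_over SK setT X -> U `<=` proj1st X -> open U -> U !=set0 ->
    (forall a, U a -> interior (fiber X a) !=set0) ->
    interior X !=set0
}.

Record matroid (M : Type) (cl : set M -> set M) : Prop := {
  cl_sub : forall X, X `<=` cl X;
  cl_mono : forall X Y, X `<=` Y -> cl X `<=` cl Y;
  cl_idem : forall X, cl (cl X) = cl X;
  cl_finitary : forall X,
    cl X = \bigcup_(A in [set A | A `<=` X /\ finite_set A]) cl A;
  cl_exchange : forall X a c,
    (cl (X `|` [set c]) `\` cl X) a -> cl (X `|` [set a]) c
}.

Definition narrow (L : language) (M : Type) (S : structure L M)
    (cl : set M -> set M) (m : nat) (phi : formula L m.+1) : Prop :=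
  forall (a : M) (b : 'I_m -> M), sat S phi (scons a b) -> cl (range b) a.

Definition definable_matroid (L : language) (M : Type) (S : structure L M)
    (cl : set M -> set M) : Prop :=
  forall A : set M,
    cl A = [set x | exists (m : nat) (phi : formula L m.+1) (a : 'I_m -> M),
              [/\ narrow S cl phi, forall i, A (a i) & solutions S phi a x]].

Definition existence (kappa : Type) (L : language) (M : Type)
    (S : structure L M) (cl : set M -> set M) : Prop :=
  forall (a : M) (B C : set M),
    small kappa B -> small kappa C -> ~ cl B a ->
    exists a', same_type S B a a' /\ ~ cl (B `|` C) a'.

Definition trivial_matroid (M : Type) : set M -> set M := fun _ => [set: M].

Record existential_matroid (kappa : Type) (L : language) (M : Type)
    (S : structure L M) (cl : set M -> set M) : Prop := {
  exmat_matroid : matroid cl;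
  exmat_definable : definable_matroid S cl;
  exmat_existence : existence kappa S cl;
  exmat_nontrivial : cl <> @trivial_matroid M
}.

Definition Zcl (L : language) (M : topologicalType) (S : structure L M)
    (A : set M) : set M :=
  [set b | exists X : set M,
     [/\ definable1_over S A X, interior X = set0 & X b]].

(* Main.v *)
Require Import Defs.
From mathcomp Require Import all_boot boolp classical_sets functions.
From mathcomp Require Import cardinality topology.

(**
A point of [Zcl A] lies in an [A]-definable set with empty interior. Such a set
is a finite union of discrete sets, so its Cantor-Bendixson derivatives
eventually vanish, and the point lies in the set of isolated points of some
iterated derivative. Hence membership in [Zcl A] is always witnessed by a
formula whose instances are all discrete. Definability and finiteness of
character follow at once.

Transitivity: if [b] lies in a discrete set [X_c] and each [c_i] in a discrete
[A]-definable set, then [(b, c)] lies in an [A]-definable discrete set, whose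
first projection has empty interior by condition 4. Exchange: if [a] lies in the
discrete set [X_c] while [a] is not in [Zcl A] and [c] not in [Zcl (A, a)], then
the set of [s] such that [{t | s in X_t}] has interior is [A]-definable and
contains [a], so it has interior; by condition 5 some [X_t] has interior, which
is absurd. Existence and non-triviality are saturation arguments, because finite
unions of definable sets with empty interior have empty interior. Conditions 1, 2,
4 and 5 reach [M] by elementarity, once the topology is expressed through the
basic sets defined by [Phi].
*)

Set Implicit Arguments.
Unset Strict Implicit.
Unset Printing Implicit Defensive.

Local Open Scope classical_set_scope.

(** * Cardinals *)

Lemma card_leTE (T U : Type) (B : set U) :
  ([set: T] #<= B)%card <->
  exists g : T -> U, injective g /\ forall x, B (g x).
Proof.
split=> [/card_leP [g]|[g [gI gB]]].
- exists (fun x => set_val (g (SigSub (mem_set (I : [set: T] x))))); split.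
  + move=> x y /val_inj /(inj (mem_set I) (mem_set I)).
    by move=> /(congr1 set_val).
  + by move=> x; exact: set_valP.
- have gI' : {in [set: T] &, injective g} by move=> x y _ _; exact: gI.
  apply: (card_le_trans _ (subset_card_le (_ : g @` [set: T] `<=` B))).
    by have /card_esym := inj_card_eq gI'; rewrite card_eq_le => /andP[].
  by move=> _ [x _ <-].
Qed.

Lemma infinite_inj_nat (T : Type) (A : set T) :
  infinite_set A -> exists s : nat -> T, injective s /\ forall k, A (s k).
Proof. by move=> /infiniteP /card_leTE. Qed.

Lemma finite_inj_nat (T : Type) (A : set T) : finite_set A ->
  exists e : T -> nat, forall x y, A x -> A y -> e x = e y -> x = y.
Proof.
move=> /finite_set_countable /countable_injP [e eI].
by exists e => x y Ax Ay; apply: eI; exact: mem_set.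
Qed.

Lemma odd_double_neq i j : i.*2.+1 = j.*2 -> False.
Proof. by move=> /(congr1 odd) /=; rewrite !odd_double. Qed.

(** Hilbert's hotel along a sequence of distinct points off [D]: the points of [D] go to its even
    places, its own [k]-th point goes to place [2k + 1], and the rest stays fixed. *)
Lemma infinite_avoid_finite (T : Type) (D : set T) :
  infinite_set [set: T] -> finite_set D ->
  exists g : T -> T, injective g /\ forall x, ~ D (g x).
Proof.
move=> Tinf Dfin.
have /infinite_inj_nat [s [sI sD]] : infinite_set (~` D).
  move=> Cfin; apply: Tinf; rewrite -(setUv D).
  by rewrite finite_setU.
have [e eI] := finite_inj_nat Dfin.
pose g x := if pselect (D x) is left _ then s (e x).*2 else
  if pselect (exists k, s k = x) is left h then s (projT1 (cid h)).*2.+1 else x.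
have ns x k : ~ (exists k, s k = x) -> s k <> x by move=> nx sx; apply: nx; exists k.
exists g; split=> [x y|x]; rewrite /g; last first.
  case: pselect => [_|nDx]; first exact: sD.
  by case: pselect => [h|_] //; exact: sD.
have odd_even i j : s i.*2.+1 <> s j.*2 by move/sI/odd_double_neq.
case: (pselect (D x)) (pselect (D y)) => [Dx|nDx] [Dy|nDy].
- by move=> /sI /double_inj; exact: eI.
- by case: pselect => [h /esym /odd_even|/ns ny /ny].
- by case: pselect => [h /odd_even|/ns nx /esym /nx].
- case: (pselect (exists k, s k = x)) (pselect (exists k, s k = y)) =>
    [h|hx] [h'|hy] //.
  + move=> /sI [] /double_inj; case: (cid h) (cid h') => k ek [k' ek'] /=.
    by rewrite -ek -ek' => ->.
  + by move/(ns _ _ hy).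
  + by move/esym/(ns _ _ hx).
Qed.

(** * Injections of an infinite type into one side of a partition *)

Section Partition.
Context {T : Type} (P : set T).

Let alternating (s : nat -> T) :=
  injective s /\ forall k, P (s k.*2) /\ ~ P (s k.*2.+1).

Let disjoint_family (F : set (nat -> T)) :=
  F `<=` alternating /\
  forall s t i j, F s -> F t -> s i = t j -> s = t.

Let covered (F : set (nat -> T)) x := exists2 sk, F sk.1 & sk.1 sk.2 = x.

(** Zorn's lemma gives a maximal family. Were both remainders infinite, interleaving a sequence from
    each would give an alternating sequence off the family, against maximality. *)
Let maximal_family : exists F, disjoint_family F /\
  (finite_set (P `\` covered F) \/ finite_set (~` P `\` covered F)).
Proof.
have [G chG|F [[Falt Fdis] Fmax]] := @Zorn_bigcup _ disjoint_family.
  move=> Gtot; split=> [s [F GF Fs]|s t i j [F1 G1 F1s] [F2 G2 F2t]].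
    by have [+ _] := chG _ GF; exact.
  have [F12|F21] := Gtot _ _ G1 G2.
    by have [_] := chG _ G2; apply => //; exact: F12.
  by have [_] := chG _ G1; apply => //; exact: F21.
exists F; split=> //; apply: contrapT => /not_orP[].
move=> /infinite_inj_nat [p [pI pP]] /infinite_inj_nat [q [qI qP]].
pose s k := if odd k then q k./2 else p k./2.
have s_even k : s k.*2 = p k by rewrite /s odd_double doubleK.
have s_odd k : s k.*2.+1 = q k.
  by rewrite /s /= odd_double /= uphalf_double.
have sC k : ~ covered F (s k).
  by rewrite /s; case: odd; [have [_] := qP k./2|have [_] := pP k./2].
have salt : alternating s.
  split=> [i j|k]; last first.
    by rewrite s_even s_odd; split; [have [] := pP k|have [] := qP k].
  rewrite /s -{4}(odd_double_half i) -{4}(odd_double_half j).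
  case: (odd i) (odd j) => -[] /=.
  - by move=> /qI ->.
  - by move=> e; have [nP _] := qP i./2; case: nP; rewrite e; have [] := pP j./2.
  - by move=> e; have [nP _] := qP j./2; case: nP; rewrite -e; have [] := pP i./2.
  - by move=> /pI ->.
apply: (Fmax (F `|` [set s])).
  split=> [|sub]; first by move=> t Ft; left.
  by apply: (sC 0); exists (s, 0) => //=; apply: sub; right.
split=> [t [Ft|->]|t u i j [Ft|->] [Fu|->]] //; first exact: Falt.
- exact: Fdis.
- by move=> e; case: (sC j); rewrite -e; exists (t, i).
- by move=> e; case: (sC i); rewrite e; exists (u, j).
Qed.

(* Along a maximal family of disjoint sequences alternating between [P] and its
   complement, one can shift everything to one side: what is not on a sequence
   lies on that side, up to finitely many points. *)
Lemma infinite_inj_part : infinite_set [set: T] ->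
  exists g : T -> T, injective g /\ ((forall x, P (g x)) \/ forall x, ~ P (g x)).
Proof.
move=> Tinf; have [F [[Falt Fdis] Ffin]] := maximal_family.
pose side (b : bool) x := if b then P x else ~ P x.
(* Only finitely many points off the sequences lie on the wrong side for [b]; the injection [h]
   avoids them. *)
have [b bfin] : exists b, finite_set (~` side b `\` covered F).
  case: Ffin => fin; [exists false|exists true] => //.
  by apply: sub_finite_set fin => x [/contrapT].
have [h [hI hD]] := infinite_avoid_finite Tinf bfin.
(* On a sequence, place [i] moves to [2i] for the side [P] and to [2i + 1] for its complement, which
   is on side [b]. *)
pose g x := if pselect (covered F x) is left c then
  (projT1 (cid2 c)).1 (~~ b + (projT1 (cid2 c)).2.*2) else x.
have gI : injective g.
  move=> x y; rewrite /g.
  case: (pselect (covered F x)) (pselect (covered F y)) => [cx|ncx] [cy|ncy] //.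
  - case: (cid2 cx) (cid2 cy) => -[s i] /= Fs <- [[t j] /= Ft <-] e.
    have st := Fdis _ _ _ _ Fs Ft e; move: e; rewrite st.
    have [tI _] := Falt _ Ft; move=> /tI /eqP.
    by rewrite eqn_add2l => /eqP /double_inj ->.
  - move=> e; case: ncy; rewrite -e; case: (cid2 cx) => -[s i] /= Fs _.
    by exists (s, ~~ b + i.*2).
  - move=> e; case: ncx; rewrite e; case: (cid2 cy) => -[s i] /= Fs _.
    by exists (s, ~~ b + i.*2).
exists (g \o h); split; first exact: inj_comp.
suff: forall x, side b (g (h x)) by rewrite /side; case: (b); [left|right].
move=> x; rewrite /g; case: pselect => [c|nc]; last first.
  by apply: contrapT => nb; apply: (hD x).
case: (cid2 c) => -[s i] /= Fs _; have [_ /(_ i) []] := Falt _ Fs.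
by rewrite /side; case: (b).
Qed.

End Partition.

(** By [infinite_inj_part], an injection of [kappa] into the union composes with a self-injection of
    [kappa] so as to land in [B] alone or in [C] alone. The same lemma, used on [kappa + kappa],
    folds two copies of [kappa] injectively into one, which bounds the union. *)
Lemma small_setU (kappa T : Type) (B C : set T) : infinite_set [set: kappa] ->
  small kappa B -> small kappa C -> small kappa (B `|` C).
Proof.
move=> kinf [/card_leP [b] nB] [/card_leP [c] nC]; split; last first.
  move=> /card_leTE [i [iI iBC]].
  have [g [gI [gB|gC]]] := infinite_inj_part (B \o i) kinf.
    by apply: nB; apply/card_leTE; exists (i \o g); split=> //; exact: inj_comp.
  apply: nC; apply/card_leTE; exists (i \o g); split; first exact: inj_comp.
  by move=> x; have [/(gC x)|] := iBC (g x).
have [d dI] : exists d : kappa + kappa -> kappa, injective d.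
  have Sinf : infinite_set [set: kappa + kappa].
    apply: contra_not kinf => /card_le_finite; apply; apply/card_leTE.
    by exists inl; split=> // x y [].
  pose left_ (x : kappa + kappa) := if x is inl _ then True else False.
  pose fold (x : kappa + kappa) := match x with inl y | inr y => y end.
  have [g [gI gP]] := infinite_inj_part (left_ : set _) Sinf.
  exists (fold \o g) => x y /=; case: gP => gP e; apply: gI; move: e;
    by move: (gP x) (gP y); case: (g x) (g y) => [?|?] [?|?] //= _ _ ->.
have bI : injective b by move=> u v; apply: inj; exact: mem_set.
have cI : injective c by move=> u v; apply: inj; exact: mem_set.
have f0 (x : set_type (B `|` C)) : ~ B (set_val x) -> C (set_val x).
  by have := set_valP x; case.
pose f (x : set_type (B `|` C)) : kappa := d (match pselect (B (set_val x)) with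
  | left Bx => inl (set_val (b (SigSub (mem_set Bx))))
  | right nBx => inr (set_val (c (SigSub (mem_set (f0 x nBx))))) end).
have fI : injective f.
  move=> x y; rewrite /f => /dI.
  case: pselect => [Bx|nBx]; case: pselect => [By|nBy] // [].
    by move=> /val_inj /bI /(congr1 set_val) /= e; exact: val_inj.
  by move=> /val_inj /cI /(congr1 set_val) /= e; exact: val_inj.
rewrite -(card_le_eql (card_setT _)); apply/card_leTE; exists f; split=> //.
Qed.

(** * Uniform first-order definability *)

Section Renaming.
Context {L : language}.

Lemma fcat_lshift (T : Type) (m n : nat) (u : 'I_m -> T) (v : 'I_n -> T) i :
  fcat u v (lshift n i) = u i.
Proof. by rewrite /fcat (unsplitK (inl i : 'I_m + 'I_n)). Qed.

Lemma fcat_rshift (T : Type) (m n : nat) (u : 'I_m -> T) (v : 'I_n -> T) i :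
  fcat u v (rshift m i) = v i.
Proof. by rewrite /fcat (unsplitK (inr i : 'I_m + 'I_n)). Qed.

Lemma scons0 (T : Type) (n : nat) (x : T) (v : 'I_n -> T) : scons x v ord0 = x.
Proof.
have -> : @ord0 n = lshift n (@ord0 0) by exact: val_inj.
exact: fcat_lshift.
Qed.

Lemma sconsS (T : Type) (n : nat) (x : T) (v : 'I_n -> T) i :
  scons x v (lift ord0 i) = v i.
Proof.
have -> : lift ord0 i = rshift 1 i by exact: val_inj.
exact: fcat_rshift.
Qed.

Lemma scons_eta (T : Type) (n : nat) (v : 'I_n.+1 -> T) :
  scons (v ord0) (fun i => v (lift ord0 i)) = v.
Proof.
by apply/funext => i; case: (unliftP ord0 i) => [j|] ->; rewrite ?sconsS ?scons0.
Qed.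

Lemma fcat_scons (T : Type) (m n : nat) (x : T) (u : 'I_m -> T) (v : 'I_n -> T) :
  scons x (fcat u v) = fcat (scons x u) v.
Proof.
apply/funext => i; case: (unliftP ord0 i) => [j|] ->.
  rewrite sconsS; case: (split_ordP j) => k ->.
    rewrite (_ : lift _ _ = lshift n (lift ord0 k)); last exact: val_inj.
    by rewrite !fcat_lshift sconsS.
  rewrite (_ : lift _ _ = rshift m.+1 k); last exact: val_inj.
  by rewrite !fcat_rshift.
rewrite scons0 (_ : ord0 = lshift n (@ord0 m)); last exact: val_inj.
by rewrite fcat_lshift scons0.
Qed.

Lemma comp_scons (T U : Type) (n : nat) (g : T -> U) (x : T) (v : 'I_n -> T) :
  g \o scons x v = scons (g x) (g \o v).
Proof.
by rewrite -[LHS]scons_eta /= scons0; congr scons; apply/funext => i; rewrite /= sconsS.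
Qed.

Definition ord_up (n m : nat) (r : 'I_n -> 'I_m) : 'I_n.+1 -> 'I_m.+1 :=
  scons ord0 (fun i => lift ord0 (r i)).

Lemma scons_up (T : Type) (n m : nat) (r : 'I_n -> 'I_m) (x : T) (v : 'I_m -> T) :
  scons x v \o ord_up r = scons x (v \o r).
Proof.
rewrite /ord_up comp_scons scons0; congr scons.
by apply/funext => i; rewrite /= sconsS.
Qed.

Fixpoint rename_term (n m : nat) (r : 'I_n -> 'I_m) (t : term L n) : term L m :=
  match t with
  | Var i => Var L (r i)
  | App f args => App f (fun i => rename_term r (args i))
  end.

(** The renaming comes after the recursive argument, because it and its target arity change under a
    quantifier. *)
Fixpoint rename (n : nat) (phi : formula L n) :
    forall m, ('I_n -> 'I_m) -> formula L m :=
  match phi with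
  | Bot _ => fun m _ => Bot L m
  | Eq _ s t => fun m r => Eq (rename_term r s) (rename_term r t)
  | Rel _ R args => fun m r => Rel R (fun i => rename_term r (args i))
  | Imp _ phi psi => fun m r => Imp (rename phi r) (rename psi r)
  | All _ phi => fun m r => All (rename phi (ord_up r))
  end.

Lemma eval_rename (T : Type) (S : structure L T) (n m : nat) (r : 'I_n -> 'I_m)
    (v : 'I_m -> T) (t : term L n) :
  Defs.eval S v (rename_term r t) = Defs.eval S (v \o r) t.
Proof.
by elim: t => //= f args IH; congr (fint S f); apply/funext => i; exact: IH.
Qed.

Lemma sat_rename (T : Type) (S : structure L T) (n : nat) (phi : formula L n) :
  forall (m : nat) (r : 'I_n -> 'I_m) (v : 'I_m -> T),
  sat S (rename phi r) v <-> sat S phi (v \o r).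
Proof.
elim: phi => //= {}n.
- by move=> s t m r v; rewrite !eval_rename.
- move=> R args m r v.
  rewrite (_ : (fun i => Defs.eval S v _) = (fun i => Defs.eval S (v \o r) (args i)))//.
  by apply/funext => i; rewrite eval_rename.
- by move=> phi IHphi psi IHpsi m r v; rewrite IHphi IHpsi.
- by move=> phi IH m r v; split=> H x; have := H x; rewrite IH scons_up.
Qed.

Fixpoint Alls (k n : nat) : formula L (k + n) -> formula L n :=
  match k with
  | 0 => id
  | k'.+1 => fun phi => Alls (All (phi : formula L (k' + n).+1))
  end.

Lemma sat_Alls (T : Type) (S : structure L T) (k n : nat)
    (phi : formula L (k + n)) (v : 'I_n -> T) :
  sat S (Alls phi) v <-> forall y : 'I_k -> T, sat S phi (fcat y v).
Proof.
elim: k phi => [|k IH] phi /=.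
  have E (y : 'I_0 -> T) : fcat y v = v.
    apply/funext => i; have {1}-> : i = rshift 0 i by exact: val_inj.
    exact: fcat_rshift.
  split=> [H y|H]; first by rewrite E.
  have y : 'I_0 -> T by case.
  by rewrite -(E y).
rewrite IH; split=> [H y|H y x].
  by rewrite -(scons_eta y) -fcat_scons; exact: H.
by rewrite fcat_scons; exact: H.
Qed.

End Renaming.

Section UniformDefinability.
Context {L : language}.

(* [R] is given by one formula, in all structures at once; the variables are
   indexed by [I]. *)
Definition fo_def (I : Type)
    (R : forall T (S : structure L T), (I -> T) -> Prop) : Prop :=
  exists n (phi : formula L n) (s : 'I_n -> I),
    forall T (S : structure L T) (v : I -> T), R T S v <-> sat S phi (v \o s).

Lemma fo_ext (I : Type) (R R' : forall T (S : structure L T), (I -> T) -> Prop) :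
  (forall T S v, R T S v <-> R' T S v) -> fo_def R' -> fo_def R.
Proof.
by move=> RR' [n [phi [s H]]]; exists n, phi, s => T S v; rewrite RR'.
Qed.

(** Leads from an arbitrary index type back to numbered variables, with a prescribed numbering
    [r]. *)
Lemma fo_formula (I : Type) (R : forall T (S : structure L T), (I -> T) -> Prop)
    (n : nat) (r : I -> 'I_n) : fo_def R ->
  exists phi : formula L n, forall T (S : structure L T) (w : 'I_n -> T),
    sat S phi w <-> R T S (w \o r).
Proof.
move=> [k [phi [s H]]]; exists (rename phi (r \o s)) => T S w.
by rewrite sat_rename H.
Qed.

Lemma fo_elementary (I : Type) (K M : Type) (SK : structure L K)
    (SM : structure L M) (f : K -> M)
    (R : forall T (S : structure L T), (I -> T) -> Prop) (v : I -> K) :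
  elementary_embedding SK SM f -> fo_def R -> R K SK v <-> R M SM (f \o v).
Proof. by move=> fe [n [phi [s H]]]; rewrite !H fe. Qed.

Lemma fo_reindex (I J : Type) (g : I -> J)
    (R : forall T (S : structure L T), (I -> T) -> Prop) :
  fo_def R -> fo_def (fun T S (w : J -> T) => R T S (fun i => w (g i))).
Proof. by move=> [n [phi [s H]]]; exists n, phi, (g \o s) => T S v; rewrite H. Qed.

Lemma fo_sat (I : Type) (n : nat) (phi : formula L n) (s : 'I_n -> I) :
  fo_def (fun T S (v : I -> T) => sat S phi (fun i => v (s i))).
Proof. by exists n, phi, s. Qed.

Lemma fo_eq (I : Type) (i j : I) : fo_def (fun T S (v : I -> T) => v i = v j).
Proof.
exists 2, (Eq (Var L ord0) (Var L ord_max)), (fun k => if k == ord0 then i else j).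
by [].
Qed.

Lemma fo_false (I : finType) : fo_def (fun T S (v : I -> T) => False).
Proof. by exists #|I|, (Bot L _), enum_val. Qed.

Lemma fo_imp (I : Type) (R R' : forall T (S : structure L T), (I -> T) -> Prop) :
  fo_def R -> fo_def R' -> fo_def (fun T S v => R T S v -> R' T S v).
Proof.
move=> [n [phi [s H]]] [n' [phi' [s' H']]]; exists (n + n').
exists (Imp (rename phi (lshift n')) (rename phi' (@rshift n n'))), (fcat s s').
move=> T S v /=; rewrite !sat_rename H H'.
have -> : (v \o fcat s s') \o lshift n' = v \o s.
  by apply/funext => i; rewrite /= fcat_lshift.
have -> // : (v \o fcat s s') \o @rshift n n' = v \o s'.
by apply/funext => i; rewrite /= fcat_rshift.
Qed.

Lemma fo_not (I : finType) (R : forall T (S : structure L T), (I -> T) -> Prop) :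
  fo_def R -> fo_def (fun T S v => ~ R T S v).
Proof. by move=> RI; apply: fo_imp => //; exact: fo_false. Qed.

Lemma fo_and (I : finType) (R R' : forall T (S : structure L T), (I -> T) -> Prop) :
  fo_def R -> fo_def R' -> fo_def (fun T S v => R T S v /\ R' T S v).
Proof.
move=> RI RI'; apply: (@fo_ext _ _ (fun T S v => ~ (R T S v -> ~ R' T S v))).
  by move=> T S v; split=> [[Rv Rv'] /(_ Rv)//|]; rewrite not_implyE notK.
by apply: fo_not; apply: fo_imp => //; exact: fo_not.
Qed.

(** A finite conjunction, built along the enumeration of [J]: the quantifier ranges over indices,
    not over elements of the structure. *)
Lemma fo_fin_all (I J : finType)
    (R : J -> forall T (S : structure L T), (I -> T) -> Prop) :
  (forall j, fo_def (R j)) -> fo_def (fun T S v => forall j, R j T S v).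
Proof.
move=> RI; apply: (@fo_ext _ _
    (fun T S v => forall j, j \in enum J -> R j T S v)).
  by move=> T S v; split=> H j; [move=> _|]; apply: H; rewrite mem_enum.
elim: (enum J) => [|j s IH].
  apply: fo_ext (fo_not (fo_false I)) => T S v.
  by split=> [_ []|_ j]; rewrite ?in_nil.
apply: (@fo_ext _ _ (fun T S v => R j T S v /\ forall k, k \in s -> R k T S v)).
  move=> T S v; split=> [H|[Rj Rs] k].
    by split=> [|k ks]; apply: H; rewrite inE ?eqxx ?ks ?orbT.
  by rewrite inE => /orP[/eqP->|/Rs].
exact: fo_and.
Qed.

Lemma fo_all (I J : finType)
    (P : forall T (S : structure L T), (I -> T) -> (J -> T) -> Prop) :
  fo_def (fun T S (w : I + J -> T) =>
    P T S (fun i => w (inl i)) (fun j => w (inr j))) ->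
  fo_def (fun T S v => forall y, P T S v y).
Proof.
(* [Alls] binds the initial variables, so those of [J] come before those of [I]. *)
pose r (k : I + J) : 'I_(#|J| + #|I|) := match k with
  | inl i => rshift #|J| (enum_rank i) | inr j => lshift #|I| (enum_rank j) end.
move=> /(fo_formula r) [phi H]; exists #|I|, (Alls phi), enum_val => T S v.
rewrite sat_Alls.
have E y : sat S phi (fcat y (v \o enum_val)) <-> P T S v (y \o enum_rank).
  rewrite H /=.
  have -> : (fun i => fcat y (v \o enum_val) (rshift #|J| (enum_rank i))) = v.
    by apply/funext => i; rewrite fcat_rshift /= enum_rankK.
  have -> // : (fun j => fcat y (v \o enum_val) (lshift #|I| (enum_rank j))) =
    y \o enum_rank.
  by apply/funext => j; rewrite fcat_lshift.
split=> [Py y|Py y]; first by apply/E.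
have /E := Py (y \o enum_val).
by rewrite (_ : (_ \o _) \o _ = y)//; apply/funext => j /=; rewrite enum_rankK.
Qed.

Lemma fo_ex (I J : finType)
    (P : forall T (S : structure L T), (I -> T) -> (J -> T) -> Prop) :
  fo_def (fun T S (w : I + J -> T) =>
    P T S (fun i => w (inl i)) (fun j => w (inr j))) ->
  fo_def (fun T S v => exists y, P T S v y).
Proof.
move=> PI; apply: (@fo_ext _ _ (fun T S v => ~ forall y, ~ P T S v y)).
  by move=> T S v; rewrite -existsNE; split=> -[y Py]; exists y; move: Py; rewrite notK.
by apply: fo_not; apply: fo_all; exact: fo_not.
Qed.

Lemma fo_all1 (I : finType)
    (P : forall T (S : structure L T), (I -> T) -> T -> Prop) :
  fo_def (fun T S (w : I + unit -> T) => P T S (fun i => w (inl i)) (w (inr tt))) ->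
  fo_def (fun T S v => forall x, P T S v x).
Proof.
move=> PI; apply: (@fo_ext _ _ (fun T S v => forall y : unit -> T, P T S v (y tt))).
  by move=> T S v; split=> H x; [|exact: (H (fun=> x))]; exact: H.
exact: fo_all.
Qed.

Lemma fo_ex1 (I : finType)
    (P : forall T (S : structure L T), (I -> T) -> T -> Prop) :
  fo_def (fun T S (w : I + unit -> T) => P T S (fun i => w (inl i)) (w (inr tt))) ->
  fo_def (fun T S v => exists x, P T S v x).
Proof.
move=> PI; apply: (@fo_ext _ _ (fun T S v => exists y : unit -> T, P T S v (y tt))).
  by move=> T S v; split=> -[x Px]; [exists (fun=> x)|exists (x tt)].
exact: fo_ex.
Qed.

(** The parameters are indexed by [P], and the [unit] summand is the place of the element. *)
Definition fo_family (P : Type)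
    (F : forall T, structure L T -> (P -> T) -> set T) : Prop :=
  fo_def (fun T S (w : P + unit -> T) => F T S (fun p => w (inl p)) (w (inr tt))).

Lemma fo_fiber (P I : Type) (F : forall T, structure L T -> (P -> T) -> set T)
    (g : P -> I) (i : I) : fo_family F ->
  fo_def (fun T S (w : I -> T) => F T S (fun p => w (g p)) (w i)).
Proof. exact: (fo_reindex (fun k => match k with inl p => g p | inr _ => i end)). Qed.

Lemma fo_solutions (I : Type) (m : nat) (phi : formula L m.+1) (a : 'I_m -> I)
    (i : I) :
  fo_def (fun T S (w : I -> T) => solutions S phi (fun j => w (a j)) (w i)).
Proof.
apply: fo_ext (fo_sat phi (scons i a)) => T S v.
by rewrite -/(v \o scons i a) comp_scons.
Qed.

(** Lets definable sets be built by logical operations on families, without writing formulas. *)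
Lemma definable1_overP (M : Type) (S : structure L M) (A X : set M) :
  definable1_over S A X <->
  exists (n : nat) (F : forall T, structure L T -> ('I_n -> T) -> set T)
    (p : 'I_n -> M),
    [/\ fo_family F, forall i, A (p i) & X = F M S p].
Proof.
split=> [[psi [Apsi ->]]|[n [F [p [FI Ap ->]]]]].
- exists (nparam psi), (fun T S p => solutions S (lform psi) p), (param psi).
  split=> //; exact: fo_solutions.
- have [phi H] := fo_formula
    (fun k : 'I_n + unit => if k is inl i then rshift 1 i else lshift n ord0) FI.
  exists (LFormula (phi : formula L (1 + n)) p); split=> //.
  apply/seteqP; split=> x; rewrite /holds1 /holds/= H /=;
  rewrite fcat_lshift (_ : (fun i => fcat _ p (rshift 1 i)) = p)//;
  by apply/funext => i; rewrite fcat_rshift.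
Qed.

Lemma fo_definable1_over (P : finType) (M : Type) (S : structure L M) (A : set M)
    (F : forall T, structure L T -> (P -> T) -> set T) (p : P -> M) :
  fo_family F -> (forall i, A (p i)) -> definable1_over S A (F M S p).
Proof.
move=> FI Ap; apply/definable1_overP.
exists #|P|, (fun T S q => F T S (fun i => q (enum_rank i))), (p \o enum_val).
split; [exact: (fo_fiber (inl \o enum_rank) (inr tt))|by move=> i; exact: Ap|].
by rewrite /=; congr (F M S _); apply/funext => i; rewrite /= enum_rankK.
Qed.

Lemma fo_definable_over (P : finType) (n : nat) (M : Type) (S : structure L M)
    (A : set M) (Z : forall T, structure L T -> (P -> T) -> set ('I_n -> T))
    (p : P -> M) :
  fo_def (fun T S (w : P + 'I_n -> T) =>
    Z T S (fun i => w (inl i)) (fun j => w (inr j))) ->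
  (forall i, A (p i)) -> definable_over S A (Z M S p).
Proof.
move=> ZI Ap; have [phi H] := fo_formula (fun k : P + 'I_n => match k with
  | inl i => rshift n (enum_rank i) | inr j => lshift #|P| j end) ZI.
exists (LFormula phi (p \o enum_val)); split; first by move=> i; exact: Ap.
apply/seteqP; split=> x; rewrite /holds/= H /=;
rewrite (_ : (fun i => fcat x _ (rshift n _)) = p);
  do ?[by apply/funext => i; rewrite fcat_rshift /= enum_rankK];
rewrite (_ : (fun i => fcat x _ (lshift _ i)) = x) //;
by apply/funext => i; rewrite fcat_lshift.
Qed.

End UniformDefinability.

(** * Negations and finite intersections in a fixed structure *)

Section DefinableSets.
Context {L : language} {M : Type} {S : structure L M}.

Definition lformula_neg (n : nat) (psi : lformula L M n) : lformula L M n :=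
  LFormula (Imp (lform psi) (Bot L _)) (param psi).

Lemma holds1_neg x psi : holds1 S x (lformula_neg psi) <-> ~ holds1 S x psi.
Proof. by []. Qed.

Lemma definable1_overI (A X Y : set M) : definable1_over S A X ->
  definable1_over S A Y -> definable1_over S A (X `&` Y).
Proof.
move=> /definable1_overP [n [F [p [FI Ap ->]]]].
move=> /definable1_overP [n' [F' [p' [FI' Ap' ->]]]].
apply: (@fo_definable1_over _ _ M S A (fun T S (q : 'I_n + 'I_n' -> T) =>
    F T S (fun i => q (inl i)) `&` F' T S (fun i => q (inr i)))
  (fun k => match k with inl i => p i | inr i => p' i end)).
  apply: fo_and; first exact: (fo_fiber (fun i => inl (inl i))).
  exact: (fo_fiber (fun i => inl (inr i))).
by case.
Qed.

Lemma definable1_over_bigcap (A : set M) (I : Type) (q : set I) (F : I -> set M) :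
  finite_set q -> (forall i, q i -> definable1_over S A (F i)) ->
  definable1_over S A (\bigcap_(i in q) F i).
Proof.
elim/Peq: I => I in q F *; move=> /finite_seqP [s ->]; elim: s => [_|i s IH Fs].
  have p0 : 'I_0 -> M by case.
  exists (@LFormula L M 1 0 (Imp (Bot L _) (Bot L _)) p0); split; first by case.
  by apply/seteqP; split=> x _; [exact: id|move=> j; rewrite /= in_nil].
rewrite (_ : [set` i :: s] = [set i] `|` [set` s]); last first.
  apply/seteqP; split=> j; rewrite /= in_cons.
    by move=> /orP[/eqP->|js]; [left|right].
  by case=> [->|/= ->]; rewrite ?eqxx ?orbT.
rewrite bigcap_setU bigcap_set1; apply: definable1_overI.
  by apply: Fs; rewrite /= mem_head.
by apply: IH => j js; apply: Fs; rewrite /= in_cons; apply/orP; right.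
Qed.

End DefinableSets.

(** * Topology given by basic sets *)

Section BasicSets.
Context {L : language} {m : nat} (Phi : formula L m.+1).

(** Non-empty interior in first-order terms. Like the definitions that follow, it replaces a
    topological notion by one that formulas express and elementarity preserves. *)
Definition contains_basic (T : Type) (S : structure L T) (X : set T) : Prop :=
  exists a : 'I_m -> T, (exists x, solutions S Phi a x) /\
    forall x, solutions S Phi a x -> X x.

Definition basic_isolated (T : Type) (S : structure L T) (X : set T) : set T :=
  [set x | X x /\ exists a : 'I_m -> T, solutions S Phi a x /\
    forall y, solutions S Phi a y -> X y -> y = x].

(** The Cantor-Bendixson derivative, with isolated points detected by basic sets. *)
Definition derived (T : Type) (S : structure L T) (X : set T) : set T :=
  [set x | X x /\ ~ basic_isolated S X x].

(** Discreteness in a finite power, tested on products of basic sets; [a (i, j)] is parameter [j] of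
    factor [i]. *)
Definition box_discrete (T : Type) (S : structure L T) (n : nat)
    (Z : set ('I_n -> T)) : Prop :=
  forall v, Z v -> exists a : 'I_n * 'I_m -> T,
    (forall i, solutions S Phi (fun j => a (i, j)) (v i)) /\
    forall w, Z w -> (forall i, solutions S Phi (fun j => a (i, j)) (w i)) ->
      forall i, w i = v i.

(** Non-empty interior in the plane. For a basic set, [contains_basic] merely says that it has a
    point. *)
Definition contains_box (T : Type) (S : structure L T) (Z : T -> T -> Prop) : Prop :=
  exists a c : 'I_m -> T, contains_basic S (solutions S Phi a) /\
    contains_basic S (solutions S Phi c) /\
    forall x, solutions S Phi a x -> forall y, solutions S Phi c y -> Z x y.

Lemma fo_contains_basic (P : finType)
    (F : forall T, structure L T -> (P -> T) -> set T) :
  fo_family F -> fo_def (fun T S p => contains_basic S (F T S p)).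
Proof.
move=> FI; apply: (fo_ex (J := 'I_m)) => /=; apply: fo_and.
  by apply: fo_ex1; exact: fo_solutions.
apply: fo_all1; apply: fo_imp; first exact: fo_solutions.
exact: (fo_fiber (fun p => inl (inl p))).
Qed.

Lemma fo_basic_isolated (P : finType)
    (F : forall T, structure L T -> (P -> T) -> set T) :
  fo_family F -> fo_family (fun T S p => basic_isolated S (F T S p)).
Proof.
move=> FI; apply: fo_and => //.
apply: (fo_ex (J := 'I_m)) => /=; apply: fo_and; first exact: fo_solutions.
apply: fo_all1; apply: fo_imp; first exact: fo_solutions.
apply: fo_imp; last exact: fo_eq.
exact: (fo_fiber (fun p => inl (inl (inl p)))).
Qed.

Lemma fo_derived (P : finType) (k : nat)
    (F : forall T, structure L T -> (P -> T) -> set T) :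
  fo_family F -> fo_family (fun T S p => iter k (derived S) (F T S p)).
Proof.
move=> FI; elim: k => //= k IH; apply: fo_and => /=; first exact: IH.
by apply: fo_not; exact: fo_basic_isolated IH.
Qed.

Lemma fo_reindex2 (P J I : Type) (g : P -> I) (h : J -> I)
    (Z : forall T, structure L T -> (P -> T) -> (J -> T) -> Prop) :
  fo_def (fun T S (w : P + J -> T) =>
    Z T S (fun i => w (inl i)) (fun j => w (inr j))) ->
  fo_def (fun T S (w : I -> T) => Z T S (fun i => w (g i)) (fun j => w (h j))).
Proof. exact: (fo_reindex (fun k => match k with inl p => g p | inr j => h j end)). Qed.

Lemma fo_box_discrete (P : finType) (n : nat)
    (Z : forall T, structure L T -> (P -> T) -> set ('I_n -> T)) :
  fo_def (fun T S (w : P + 'I_n -> T) =>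
    Z T S (fun i => w (inl i)) (fun j => w (inr j))) ->
  fo_def (fun T S p => box_discrete S (Z T S p)).
Proof.
move=> ZI; apply: (fo_all (J := 'I_n)) => /=; apply: fo_imp => //.
apply: (fo_ex (J := ('I_n * 'I_m)%type)) => /=; apply: fo_and.
  by apply: fo_fin_all => i; exact: fo_solutions.
apply: (fo_all (J := 'I_n)) => /=; apply: fo_imp.
  exact: (fo_reindex2 (fun p => inl (inl (inl p))) inr).
apply: fo_imp; apply: fo_fin_all => i; [exact: fo_solutions|exact: fo_eq].
Qed.

End BasicSets.

(** * Comparison of the first-order notions with the topology *)

Section Topology.
Context {L : language} {m : nat} {Phi : formula L m.+1}.
Context {T : topologicalType} {S : structure L T} (topS : topologized_by S Phi).

Lemma open_solutions a : open (solutions S Phi a).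
Proof. by case: topS => + _; apply; exists a. Qed.

Lemma nbhs_solutions a x : solutions S Phi a x -> nbhs x (solutions S Phi a).
Proof. by move=> ax; apply: open_nbhs_nbhs; split=> //; exact: open_solutions. Qed.

Lemma nbhs_basicP x A : nbhs x A <->
  exists a, solutions S Phi a x /\ solutions S Phi a `<=` A.
Proof.
split=> [|[a [ax aA]]]; last by apply: filterS aA _; exact: nbhs_solutions.
by case: topS => _ /[apply] -[_ [[a _ <-] ax] aA]; exists a.
Qed.

Lemma interior_basicP (X : set T) : interior X !=set0 <-> contains_basic Phi S X.
Proof.
split=> [[x /nbhs_basicP [a [ax aX]]]|[a [[x ax] aX]]].
  by exists a; split=> //; exists x.
by exists x; apply/nbhs_basicP; exists a.
Qed.

Lemma interior0_basicP (X : set T) : interior X = set0 <-> ~ contains_basic Phi S X.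
Proof.
rewrite -interior_basicP; split=> [->|nX]; first by move/set0P; rewrite eqxx.
by apply/eqP; apply: contra_notT nX => /set0P.
Qed.

(** A product of finitely many basic neighbourhoods is a neighbourhood in the product topology. *)
Lemma box_discreteW (n : nat) (Z : set {ptws 'I_n -> T}) :
  box_discrete Phi S Z -> discrete_subset Z.
Proof.
move=> Zd v Zv; have [a [av aZ]] := Zd v Zv; split; first exact: mem_set.
exists [set w | forall i, solutions S Phi (fun j => a (i, j)) (w i)].
  apply: (@filter_forall _ 'I_n
    (fun i (w : {ptws 'I_n -> T}) => solutions S Phi (fun j => a (i, j)) (w i))
    (nbhs (v : {ptws 'I_n -> T}))) => i.
  exact: (@proj_continuous _ (fun=> T) i v _ (nbhs_solutions (av i))).
apply/seteqP; split=> [w [wa Zw]|w ->]; last by split.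
by apply/funext => i; exact: aZ.
Qed.

(** The map [h] from pairs to the power is continuous, so the preimage of a neighbourhood contains a
    product of two basic sets. *)
Lemma interior_contains_box (Z : T -> T -> Prop) :
  interior ([set v | Z (v ord0) (v ord_max)] : set {ptws 'I_2 -> T}) !=set0 ->
  contains_box Phi S Z.
Proof.
move=> [v vZ]; pose h (p : T * T) : {ptws 'I_2 -> T} := scons p.1 (fun=> p.2).
have hE p i : h p i = if i == ord0 then p.1 else p.2.
  rewrite /h; case: (unliftP ord0 i) => [j|] ->; first by rewrite sconsS.
  by rewrite scons0.
have hc : continuous h.
  move=> p; apply/cvg_sup => i; apply: continuous_comp_initial.
  rewrite (_ : _ \o h = if i == ord0 then fst else snd).
    by case: ifP => _ q; [exact: cvg_fst|exact: cvg_snd].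
  by apply/funext => q; rewrite /= hE; case: ifP.
have hv : h (v ord0, v ord_max) = v.
  apply/funext => i; rewrite hE; case: ifP => [/eqP->//|].
  case: (unliftP ord0 i) => [j -> _|->]; last by rewrite eqxx.
  by congr v; apply: val_inj; rewrite /= ord1.
move: vZ; rewrite /interior/= -{1}hv => /hc [[A B] /=
  [/nbhs_basicP [a [av aA]] /nbhs_basicP [c [cv cB]]] AB].
exists a, c; split; first by exists a; split=> //; exists (v ord0).
split; first by exists c; split=> //; exists (v ord_max).
move=> x ax y cy; have := AB (x, y) (conj (aA _ ax) (cB _ cy)).
by rewrite /= !hE.
Qed.

End Topology.

(** * Cantor-Bendixson derivatives *)

Section CantorBendixson.
Context {L : language} {m : nat} {Phi : formula L m.+1}.
Context {T : topologicalType} {S : structure L T} (topS : topologized_by S Phi).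
Hypothesis separated : forall x y : T, x <> y ->
  exists a, solutions S Phi a x /\ ~ solutions S Phi a y.
Hypothesis no_isolated : forall a x, solutions S Phi a x ->
  exists y, solutions S Phi a y /\ y <> x.

Let derivative k := iter k (derived Phi S).

Lemma derivative_sub k (X : set T) : derivative k X `<=` X.
Proof. by elim: k => // k IH x [/IH]. Qed.

(* The [k]-th derivative of a union of discrete sets consists of points all of
   whose neighbourhoods meet more than [k] of these sets. *)
Lemma derivative_meets (N : nat) (D : 'I_N -> set T) (k : nat) (x : T) (U : set T) :
  (forall i, discrete_subset (D i)) -> derivative k (\bigcup_i D i) x -> nbhs x U ->
  (k < #|[pred i | `[< U `&` D i !=set0 >]]|)%N.
Proof.
move=> Dd; elim: k x U => [|k IH] x U.
  move=> [i _ Dx] /nbhs_singleton Ux.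
  by apply/card_gt0P; exists i; rewrite inE; exists x.
move=> [kx nix] Ux; have /derivative_sub [i _ Dix] := kx.
have [_ [V Vx VD]] := Dd i x Dix.
have /(nbhs_basicP topS) [a [ax aUV]] : nbhs x (U `&` V) by exact: filterI.
have [y [ay ky yx]] : exists y, [/\ solutions S Phi a y,
    derivative k (\bigcup_i D i) y & y <> x].
  apply: contrapT => ny; apply: nix; split=> //; exists a; split=> // y ay ky.
  by apply: contrapT => yx; apply: ny; exists y.
(* Shrinking around [y] away from [x] loses the set [D i], which [V] meets only in [x]; the
   induction hypothesis at [y] still finds more than [k] sets. *)
have [b [by_ bx]] := separated yx.
have yab : nbhs y (solutions S Phi a `&` solutions S Phi b).
  by apply: filterI; exact: nbhs_solutions.
apply: leq_ltn_trans (IH _ _ ky yab) _; apply: proper_card; apply/properP; split.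
  apply/fintype.subsetP => j; rewrite !inE => -[z [[az _] Dz]].
  by exists z; split=> //; exact: (aUV _ az).1.
exists i; rewrite inE; first by exists x; split=> //; exact: nbhs_singleton.
apply/asboolPn => -[z [[/aUV [_ Vz] bz] Dz]]; apply: bx.
by have : (V `&` D i) z by []; rewrite VD => <-.
Qed.

(** Near a point of the [N]-th derivative there would be more than [N] of the [N] discrete sets. *)
Lemma finite_union_discrete_derivative (X : set T) :
  finite_union_discrete X -> exists k, derivative k X = set0.
Proof.
move=> [N [D [Dd ->]]]; exists N; apply/seteqP; split=> // x Nx.
have xT : nbhs x setT by exact: filterT.
have := derivative_meets Dd Nx xT.
by move=> /leq_trans/(_ (max_card _)); rewrite card_ord ltnn.
Qed.

(** As the space has no isolated points, a point of a basic set inside [X] is never isolated in [X],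
    and the whole basic set survives each derivative. *)
Lemma derivative_contains_basic k (X : set T) :
  contains_basic Phi S X -> contains_basic Phi S (derivative k X).
Proof.
move=> [a [ax aX]]; exists a; split=> //; elim: k => //= k IH x ax'.
split; first exact: IH.
move=> [_ [b [bx bk]]].
have /(nbhs_basicP topS) [c [cx cab]] :
    nbhs x (solutions S Phi a `&` solutions S Phi b).
  by apply: filterI; exact: nbhs_solutions.
have [y [cy]] := no_isolated cx; apply.
by have [ay by_] := cab _ cy; apply: bk => //; exact: IH.
Qed.

(** The converse of condition 3. Together they show that definable sets with empty interior are
    stable under finite unions. *)
Lemma finite_union_discrete_interior (X : set T) :
  finite_union_discrete X -> ~ contains_basic Phi S X.
Proof.
move=> /finite_union_discrete_derivative [k k0].
by move=> /(derivative_contains_basic k); rewrite k0 => -[a [[x ax] /(_ x ax)]].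
Qed.

Lemma basic_isolated_idem (X : set T) x : basic_isolated Phi S X x ->
  basic_isolated Phi S (basic_isolated Phi S X) x.
Proof.
move=> Xx; split=> //; case: Xx => _ [a [ax aX]].
by exists a; split=> // y ay [Xy _]; exact: aX.
Qed.

(** The first derivative of such a set is empty, whereas a basic set would survive in it. *)
Lemma isolated_contains_basic (X : set T) :
  (forall x, X x -> basic_isolated Phi S X x) -> ~ contains_basic Phi S X.
Proof.
move=> Xi /(derivative_contains_basic 1) [b [[y yb] bX]].
by have [Xy []] := bX y yb; exact: Xi.
Qed.

(** A point isolated at no stage would remain in every derivative, but these end up empty. *)
Lemma finite_union_discrete_isolated (X : set T) x : finite_union_discrete X ->
  X x -> exists k, basic_isolated Phi S (derivative k X) x.
Proof.
move=> /finite_union_discrete_derivative [N N0] Xx; apply: contrapT => ni.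
have : derivative N X x.
  by elim: (N) => // k kx; split=> // ki; apply: ni; exists k.
by rewrite N0.
Qed.

End CantorBendixson.

Lemma finite_union_discreteU (T : topologicalType) (X Y : set T) :
  finite_union_discrete X -> finite_union_discrete Y ->
  finite_union_discrete (X `|` Y).
Proof.
move=> [N [D [Dd ->]]] [N' [D' [Dd' ->]]]; exists (N + N'), (fcat D D'); split.
  by move=> i; case: (split_ordP i) => j ->; rewrite ?fcat_lshift ?fcat_rshift.
apply/seteqP; split=> [x [[i _ Dx]|[i _ Dx]]|x [i _]].
- by exists (lshift N' i) => //; rewrite fcat_lshift.
- by exists (rshift N i) => //; rewrite fcat_rshift.
- case: (split_ordP i) => j ->; rewrite ?fcat_lshift ?fcat_rshift => Dx.
  + by left; exists j.
  + by right; exists j.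
Qed.

Lemma finite_union_discrete_bigcup (T : topologicalType) (I : Type) (q : set I)
    (F : I -> set T) : finite_set q ->
  (forall i, q i -> finite_union_discrete (F i)) ->
  finite_union_discrete (\bigcup_(i in q) F i).
Proof.
elim/Peq: I => I in q F *; move=> /finite_seqP [s ->]; elim: s => [_|i s IH Fs].
  exists 0, (fun=> set0); split; first by case.
  by apply/seteqP; split=> x [].
rewrite (_ : [set` i :: s] = [set i] `|` [set` s]); last first.
  apply/seteqP; split=> j; rewrite /= in_cons.
    by move=> /orP[/eqP->|js]; [left|right].
  by case=> [->|/= ->]; rewrite ?eqxx ?orbT.
rewrite bigcup_setU bigcup_set1; apply: finite_union_discreteU.
  by apply: Fs; rewrite /= mem_head.
by apply: IH => j js; apply: Fs; rewrite /= in_cons; apply/orP; right.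
Qed.

(** * From K to the monster model *)

Section Transfer.
Context {L : language} {m : nat} {Phi : formula L m.+1}.
Context {K M : topologicalType} {SK : structure L K} {SM : structure L M}.
Context {f : K -> M} (elem : elementary_embedding SK SM f).
Hypotheses (topK : topologized_by SK Phi) (dmin : d_minimal SK SM).

(** The universal closure of [R] is a sentence. Quantifying over all parameters is what reaches
    those of [M] outside the image of [f]. *)
Lemma fo_transfer (P : finType) (R : forall T (S : structure L T), (P -> T) -> Prop) :
  fo_def R -> (forall p, R K SK p) -> forall p, R M SM p.
Proof.
move=> RI; have v : 'I_0 -> K by case.
have RA : fo_def (fun T S (_ : 'I_0 -> T) => forall p, R T S p).
  by apply: fo_all; exact: (fo_reindex inr).
by move=> RK; apply/(fo_elementary v elem RA).
Qed.

Lemma dmin_separated (x y : M) : x <> y ->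
  exists a, solutions SM Phi a x /\ ~ solutions SM Phi a y.
Proof.
pose R T (S : structure L T) (p : bool -> T) := p true <> p false ->
  exists a, solutions S Phi a (p true) /\ ~ solutions S Phi a (p false).
have RI : fo_def R.
  apply: fo_imp; first by apply: fo_not; exact: fo_eq.
  apply: (fo_ex (J := 'I_m)) => /=.
  by apply: fo_and; [exact: fo_solutions|apply: fo_not; exact: fo_solutions].
apply: (fo_transfer RI _ (fun b => if b then x else y)) => p pp.
have : nbhs (p true) (~` [set p false]).
  apply: open_nbhs_nbhs; split=> //; apply: closed_openC.
  exact: dmin_T1 dmin _.
by move=> /(nbhs_basicP topK) [a [ap aC]]; exists a; split=> // /aC; apply.
Qed.

Lemma dmin_no_isolated_basic a (x : M) : solutions SM Phi a x ->
  exists y, solutions SM Phi a y /\ y <> x.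
Proof.
pose R T (S : structure L T) (p : 'I_m + unit -> T) :=
  solutions S Phi (fun j => p (inl j)) (p (inr tt)) ->
  exists y, solutions S Phi (fun j => p (inl j)) y /\ y <> p (inr tt).
have RI : fo_def R.
  apply: fo_imp; first exact: fo_solutions.
  apply: fo_ex1; apply: fo_and; first exact: fo_solutions.
  by apply: fo_not; exact: fo_eq.
apply: (fo_transfer RI _ (fun k => match k with inl j => a j | inr _ => x end)).
move=> p ap; apply: contrapT => ny.
apply: (dmin_no_isolated dmin (x := p (inr tt))).
split; first exact: mem_set.
exists (solutions SK Phi (fun j => p (inl j))); first exact: nbhs_solutions.
apply/seteqP; split=> [y [ay _]|y ->//]; apply: contrapT => yp.
by apply: ny; exists y.
Qed.

(** Condition 4 in [M]: for the family [Z], both discreteness and empty interior are first-order in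
    the parameters. *)
Lemma dmin_projection_basic (P : finType) (n : nat)
    (Z : forall T, structure L T -> (P -> T) -> set ('I_n.+1 -> T)) (p : P -> M) :
  fo_def (fun T S (w : P + 'I_n.+1 -> T) =>
    Z T S (fun i => w (inl i)) (fun j => w (inr j))) ->
  box_discrete Phi SM (Z M SM p) ->
  ~ contains_basic Phi SM [set x | exists v, Z M SM p v /\ v ord0 = x].
Proof.
move=> ZI; pose R T (S : structure L T) (p : P -> T) :=
  box_discrete Phi S (Z T S p) ->
  ~ contains_basic Phi S [set x | exists v, Z T S p v /\ v ord0 = x].
have RI : fo_def R.
  apply: fo_imp; first exact: fo_box_discrete.
  apply: fo_not; apply: (fo_contains_basic Phi (F := fun T S p =>
    [set x | exists v, Z T S p v /\ v ord0 = x])).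
  apply: (fo_ex (J := 'I_n.+1)) => /=; apply: fo_and; last exact: fo_eq.
  exact: (fo_reindex2 (fun p => inl (inl p)) inr).
apply: (fo_transfer RI) => {}p /(box_discreteW topK) Zd.
have Zdef : definable_over SK setT (Z K SK p) by exact: fo_definable_over.
apply/(interior0_basicP topK); rewrite -(dmin_projection dmin Zdef Zd).
by congr interior; apply/seteqP; split=> x; [move=> [v [Zv vx]]|move=> [v Zv vx]];
  exists v.
Qed.

(** Condition 5 in [M], with the open set [U] taken to be basic. *)
Lemma dmin_fibers_basic (P : finType)
    (Z : forall T, structure L T -> (P -> T) -> T -> T -> Prop) (p : P -> M) :
  fo_def (fun T S (w : P + bool -> T) =>
    Z T S (fun i => w (inl i)) (w (inr true)) (w (inr false))) ->
  contains_basic Phi SM [set x | contains_basic Phi SM (Z M SM p x)] ->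
  contains_box Phi SM (Z M SM p).
Proof.
move=> ZI; pose R T (S : structure L T) (p : P -> T) :=
  contains_basic Phi S [set x | contains_basic Phi S (Z T S p x)] ->
  contains_box Phi S (Z T S p).
have ZI' (I : finType) (g : P -> I) i j :
    fo_def (fun T S (w : I -> T) => Z T S (fun u => w (g u)) (w i) (w j)).
  exact: (fo_reindex (fun k => match k with inl u => g u
    | inr true => i | inr false => j end) ZI).
have RI : fo_def R.
  apply: fo_imp.
    apply: (fo_contains_basic Phi (F := fun T S p =>
      [set x | contains_basic Phi S (Z T S p x)])).
    apply: (fo_contains_basic Phi (F := fun T S (p : P + unit -> T) =>
      Z T S (fun i => p (inl i)) (p (inr tt)))).
    exact: (ZI' _ (fun u => inl (inl u))).
  apply: (fo_ex (J := 'I_m)) => /=; apply: (fo_ex (J := 'I_m)) => /=.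
  apply: fo_and; first apply: (fo_contains_basic Phi
    (F := fun T S (p : (P + 'I_m) + 'I_m -> T) => solutions S Phi (fun j => p (inl (inr j))))); first exact: fo_solutions.
  apply: fo_and; first apply: (fo_contains_basic Phi
    (F := fun T S (p : (P + 'I_m) + 'I_m -> T) => solutions S Phi (fun j => p (inr j)))); first exact: fo_solutions.
  apply: fo_all1; apply: fo_imp; first exact: fo_solutions.
  apply: fo_all1; apply: fo_imp; first exact: fo_solutions.
  exact: (ZI' _ (fun u => inl (inl (inl (inl u))))).
apply: (fo_transfer RI) => {}p [a [a0 aZ]].
pose X : set {ptws 'I_2 -> K} := [set v | Z K SK p (v ord0) (v ord_max)].
have Xdef : definable_over SK setT X.
  apply: (@fo_definable_over _ P 2 K SK setT (fun T S p =>
    [set v : 'I_2 -> T | Z T S p (v ord0) (v ord_max)]) p) => //.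
  exact: ZI'.
have fibE x : fiber X x = Z K SK p x.
  have om : ord_max = lift ord0 (@ord0 0) by exact: val_inj.
  by apply/seteqP; split=> t; rewrite /fiber /X /= om scons0 sconsS.
apply: (interior_contains_box topK).
apply: (dmin_fibers dmin Xdef (U := solutions SK Phi a)).
- move=> x /aZ [c [[y cy] cZ]]; have := cZ y cy; rewrite -fibE => Xy.
  by exists (scons x (fun=> y)) => //; rewrite scons0.
- exact: open_solutions.
- by case: a0 => x; exists x.
- by move=> x /aZ; rewrite fibE; exact: (interior_basicP topK _).2.
Qed.

End Transfer.

(** * The closure operator *)

Section Matroid.
Context {L : language} {m : nat} {Phi : formula L m.+1}.
Context {K M : topologicalType} {SK : structure L K} {SM : structure L M}.
Context {f : K -> M} (elem : elementary_embedding SK SM f).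
Hypotheses (topK : topologized_by SK Phi) (topM : topologized_by SM Phi).
Hypothesis dmin : d_minimal SK SM.

Let sepM := dmin_separated elem topK dmin.
Let noisoM := dmin_no_isolated_basic elem topK dmin.

Lemma Zcl_fo (P : finType) (F : forall T, structure L T -> (P -> T) -> set T)
    (A : set M) (p : P -> M) b : fo_family F -> (forall i, A (p i)) ->
  ~ contains_basic Phi SM (F M SM p) -> F M SM p b -> Zcl SM A b.
Proof.
move=> FI Ap Fp Fb; exists (F M SM p); split=> //; first exact: fo_definable1_over.
exact/(interior0_basicP topM).
Qed.

Lemma discrete_contains_basic n (phi : formula L n.+1) (q : 'I_n -> M) :
  (forall x, solutions SM phi q x ->
     basic_isolated Phi SM (solutions SM phi q) x) ->
  ~ contains_basic Phi SM (solutions SM phi q).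
Proof. exact: isolated_contains_basic. Qed.

(* The isolated points of an iterated derivative are definable over the same
   parameters, and form a discrete set for all other values of these. *)
Lemma Zcl_discrete (A : set M) b : Zcl SM A b ->
  exists n (phi : formula L n.+1) (p : 'I_n -> M),
    [/\ forall i, A (p i), solutions SM phi p b &
      forall q x, solutions SM phi q x ->
        basic_isolated Phi SM (solutions SM phi q) x].
Proof.
move=> [X [Xdef X0 Xb]].
have Xfin : finite_union_discrete X.
  by apply: (dmin_empty_interior dmin) X0; case: Xdef => psi [_ ->]; exists psi.
have [k kb] := finite_union_discrete_isolated topM sepM Xfin Xb.
move/definable1_overP: Xdef => [n [F [p [FI Ap XE]]]].
have /(fo_formula (fun u : 'I_n + unit => if u is inl i then lift ord0 i else ord0))
  [phi phiE] := fo_basic_isolated Phi (fo_derived Phi k FI).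
have E q : solutions SM phi q =
    basic_isolated Phi SM (iter k (derived Phi SM) (F M SM q)).
  apply/seteqP; split=> x; rewrite /solutions /= phiE /= scons0;
  by rewrite (_ : (fun i => scons x q (lift ord0 i)) = q)//;
    apply/funext => i; rewrite sconsS.
exists n, phi, p; split=> // [|q x]; first by rewrite E -XE.
by rewrite E; exact: basic_isolated_idem.
Qed.

(** A singleton contains no basic set, since no basic set has exactly one point. *)
Lemma Zcl_sub (A : set M) : A `<=` Zcl SM A.
Proof.
move=> x Ax; apply: (@Zcl_fo unit (fun T S p => [set y | y = p tt]) _ (fun=> x)) => //.
  exact: fo_eq.
by move=> [a [[y ay] /=]] ax; have [z [az]] := noisoM ay; rewrite (ax _ az) (ax _ ay).
Qed.

Lemma Zcl_mono (A B : set M) : A `<=` B -> Zcl SM A `<=` Zcl SM B.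
Proof.
move=> AB b [X [[psi [Apsi XE]] X0 Xb]]; exists X; split=> //.
by exists psi; split=> // i; exact: AB.
Qed.

Lemma Zcl_solutions n (phi : formula L n.+1) (p : 'I_n -> M) b :
  ~ contains_basic Phi SM (solutions SM phi p) -> solutions SM phi p b ->
  Zcl SM (range p) b.
Proof.
apply: (Zcl_fo (F := fun T S p => solutions S phi p)); first exact: fo_solutions.
by move=> i; exists i.
Qed.

(* The graph of a discrete family over a discrete set is discrete, so that its
   projection has empty interior. *)
Lemma Zcl_idem (A : set M) : Zcl SM (Zcl SM A) = Zcl SM A.
Proof.
apply/seteqP; split; last exact: Zcl_sub.
move=> b /Zcl_discrete [n [phi [p [Ap phib phid]]]].
have /choice [g gP] : forall i, exists t : {k & (formula L k.+1 * ('I_k -> M))%type},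
    [/\ forall j, A ((projT2 t).2 j), solutions SM (projT2 t).1 (projT2 t).2 (p i) &
      forall q x, solutions SM (projT2 t).1 q x ->
        basic_isolated Phi SM (solutions SM (projT2 t).1 q) x].
  move=> i; have [k [psi [q H]]] := Zcl_discrete (Ap i).
  by exists (existT _ k (psi, q)).
pose N i := projT1 (g i); pose psi i : formula L (N i).+1 := (projT2 (g i)).1.
(* The formulas for the various [p i] have parameter tuples of different lengths; [P] indexes all
   these parameters together. *)
pose P := {i : 'I_n & 'I_(N i)}.
pose Z T (S : structure L T) (q : P -> T) : set ('I_n.+1 -> T) := [set v |
  solutions S phi (fun i => v (lift ord0 i)) (v ord0) /\
  forall i, solutions S (psi i) (fun j => q (existT _ i j)) (v (lift ord0 i))].
pose q (u : P) : M := (projT2 (g (projT1 u))).2 (projT2 u).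
have ZI : fo_def (fun T S (w : P + 'I_n.+1 -> T) =>
    Z T S (fun i => w (inl i)) (fun j => w (inr j))).
  apply: fo_and; first exact: fo_solutions.
  by apply: fo_fin_all => i; exact: fo_solutions.
have Zd : box_discrete Phi SM (Z M SM q).
  move=> v [v0 vS]; have [_ [a [av aP]]] := phid _ _ v0.
  have /choice [c cP] : forall i, exists c, solutions SM Phi c (v (lift ord0 i)) /\
      forall y, solutions SM Phi c y ->
        solutions SM (psi i) (fun j => q (existT _ i j)) y -> y = v (lift ord0 i).
    by move=> i; have [_ _ /(_ _ _ (vS i)) [_ [c cP]]] := gP i; exists c.
  exists (fun ij => scons a c ij.1 ij.2); split.
    move=> i; case: (unliftP ord0 i) => [j|] ->; last by rewrite /= scons0.
    by rewrite /= sconsS; have [] := cP j.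
  move=> w [w0 wS] wB.
  (* The sets given by [c] first fix all coordinates but the first; then [w ord0] lies in the same
     instance of [phi] as [v ord0], where [a] isolates it. *)
  have wl i : w (lift ord0 i) = v (lift ord0 i).
    have [_] := cP i; apply; last exact: wS.
    by have := wB (lift ord0 i); rewrite /= sconsS.
  move=> i; case: (unliftP ord0 i) => [j|] -> //; apply: aP.
    by have := wB ord0; rewrite /= scons0.
  by rewrite -(_ : (fun i => w (lift ord0 i)) = fun i => v (lift ord0 i))//;
    apply/funext.
apply: (Zcl_fo (F := fun T S q => [set x | exists v, Z T S q v /\ v ord0 = x])
    (p := q)).
- apply: (fo_ex (J := 'I_n.+1)) => /=; apply: fo_and; last exact: fo_eq.
  exact: (fo_reindex2 (fun u => inl (inl u)) inr ZI).
- by move=> [i j]; have [+ _ _] := gP i; exact.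
- exact: (dmin_projection_basic elem topK dmin ZI).
- exists (scons b p); split; last by rewrite scons0.
  split=> [|i].
    by rewrite scons0 (_ : (fun i => _) = p)//; apply/funext => i; rewrite sconsS.
  by rewrite sconsS; have [] := gP i.
Qed.

Lemma Zcl_finitary (A : set M) :
  Zcl SM A = \bigcup_(B in [set B | B `<=` A /\ finite_set B]) Zcl SM B.
Proof.
apply/seteqP; split=> b; last by move=> [B [BA _]]; exact: Zcl_mono.
move=> /Zcl_discrete [n [phi [p [Ap phib phid]]]]; exists (range p).
  by split; [move=> _ [i _ <-]|exact/finite_image/finite_finset].
exact: (Zcl_solutions (discrete_contains_basic (phid p))).
Qed.

(** The formulas from [Zcl_discrete] are narrow because all their instances, not just the given one,
    are discrete. *)
Lemma Zcl_definable : definable_matroid SM (Zcl SM).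
Proof.
move=> A; apply/seteqP; split=> b.
  move=> /Zcl_discrete [n [phi [p [Ap phib phid]]]]; exists n, phi, p; split=> //.
  by move=> x q; exact: (Zcl_solutions (discrete_contains_basic (phid q))).
move=> [n [phi [p [/(_ b p) phin Ap /phin]]]]; apply: Zcl_mono.
by move=> _ [i _ <-].
Qed.

Lemma Zcl_exchange (A : set M) a c :
  (Zcl SM (A `|` [set c]) `\` Zcl SM A) a -> Zcl SM (A `|` [set a]) c.
Proof.
move=> [/Zcl_discrete [n [phi [p [Ap phia phid]]]] nAa]; apply: contrapT => nc.
(* The parameters other than [c] lie in [A] and stay fixed; every occurrence of [c] becomes the
   variable [y] of [Z]. *)
pose P := {i : 'I_n | p i != c}.
pose Z T (S : structure L T) (q : P -> T) x y :=
  solutions S phi (fun i => if insub i is Some u then q u else y) x.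
pose q (u : P) := p (val u).
have qE : (fun i => if insub i is Some u then q u else c) = p.
  apply/funext => i; case: insubP => [u _ <-//|].
  by rewrite negbK => /eqP.
have qA u : A (q u).
  by have [//|/= pc] := Ap (val u); move: (valP u); rewrite /= pc eqxx.
have ZI : fo_def (fun T S (w : P + bool -> T) =>
    Z T S (fun i => w (inl i)) (w (inr true)) (w (inr false))).
  apply: fo_ext (fo_solutions phi (fun i =>
    if insub i is Some u then inl u else inr false) (inr true)) => T S w.
  rewrite /Z (_ : (fun i => w _) =
    (fun i => if insub i is Some u then w (inl u) else w (inr false)))//.
  by apply/funext => i; case: insub.
have ZI' (I : finType) (g : P -> I) i j :
    fo_def (fun T S (w : I -> T) => Z T S (fun u => w (g u)) (w i) (w j)).
  exact: (fo_reindex (fun k => match k with inl u => g u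
    | inr true => i | inr false => j end) ZI).
have [u [v [[d [[x dx] du]] [[e [[y ey] ev]] uvZ]]]] :
    contains_box Phi SM (Z M SM q).
  (* If the points with a fibre of non-empty interior contain no basic set, then either [a] is one
     of them, so [a] is in [Zcl SM A], or the fibre over [a] has empty interior and puts [c] in the
     closure of [A] and [a]. *)
  apply: (dmin_fibers_basic elem topK dmin ZI); apply: contrapT => nS.
  apply: nAa; apply: (Zcl_fo (F := fun T S q =>
    [set x | contains_basic Phi S (Z T S q x)]) (p := q)) => //.
    apply: (fo_contains_basic Phi (F := fun T S (p : P + unit -> T) =>
      Z T S (fun i => p (inl i)) (p (inr tt)))).
    exact: (ZI' _ (fun u => inl (inl u))).
  apply: contrapT => na; apply: nc.
  apply: (Zcl_fo (F := fun T S (p : P + unit -> T) =>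
      Z T S (fun i => p (inl i)) (p (inr tt)))
    (p := fun k => match k with inl u => q u | inr _ => a end)) => //.
  - exact: (ZI' _ (fun u => inl (inl u))).
  - by move=> [u|[]]; [left|right].
  - by rewrite /Z qE.
(* With [y] in place of [c], the instance of [phi] is still discrete, yet it contains the side [u]
   of the box. *)
apply: (discrete_contains_basic (phid (fun i => if insub i is Some u then q u else y))).
exists u; split; first by exists x; exact: du.
by move=> z uz; exact: (uvZ z uz y (ev _ ey)).
Qed.

Lemma Zcl_matroid : matroid (Zcl SM).
Proof.
split.
- exact: Zcl_sub.
- exact: Zcl_mono.
- exact: Zcl_idem.
- exact: Zcl_finitary.
- exact: Zcl_exchange.
Qed.

(** Saturation is applied to [p] with the negations of all formulas over [A] that define sets with
    empty interior. Finitely many such sets form a finite union of discrete sets, so they cannot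
    cover the basic set provided by a finite part of [p]. *)
Lemma Zcl_realize (kappa : Type) (A : set M) (p : set (lformula L M 1)) :
  saturated kappa SM -> small kappa A -> p `<=` Defs.over A (n := 1) ->
  (forall q, q `<=` p -> finite_set q ->
    contains_basic Phi SM [set x | forall psi, q psi -> holds1 SM x psi]) ->
  exists x, (forall psi, p psi -> holds1 SM x psi) /\ ~ Zcl SM A x.
Proof.
move=> satM Asmall pA pfin.
pose thin : set (lformula L M 1) :=
  [set psi | Defs.over A psi /\ ~ contains_basic Phi SM [set x | holds1 SM x psi]].
have thin_fin psi : thin psi -> finite_union_discrete [set x | holds1 SM x psi].
  move=> [Apsi npsi]; apply: (dmin_empty_interior dmin); first by exists psi.
  exact/(interior0_basicP topM).
have [||x xp] := satM A (p `|` [set lformula_neg psi | psi in thin]) Asmall.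
- by move=> psi [/pA//|[psi' [A' _] <-]].
- move=> q qsub qfin.
  have [||a [[y ay] aq]] := pfin (q `&` p).
  + by move=> psi [].
  + by apply: sub_finite_set qfin => psi [].
  pose t := q `&` [set lformula_neg psi | psi in thin].
  have tfin : finite_set t by apply: sub_finite_set qfin => psi [].
  have : ~ contains_basic Phi SM (\bigcup_(psi in t) [set x | ~ holds1 SM x psi]).
    apply: (finite_union_discrete_interior topM sepM noisoM).
    apply: finite_union_discrete_bigcup => // _ [_ [psi /thin_fin psit <-]].
    congr finite_union_discrete: psit; apply/seteqP; split=> x /=.
      by rewrite holds1_neg notK.
    by rewrite holds1_neg notK.
  apply: contra_notP => nx; exists a; split; first by exists y.
  move=> x ax; apply: contrapT => nt; apply: nx; exists x => psi qpsi.
  have [ppsi|tpsi] := qsub _ qpsi; first by apply: aq.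
  by apply: contrapT => npsi; apply: nt; exists psi.
exists x; split=> [psi ppsi|[X [[psi [Apsi ->]] X0 Xx]]]; first by apply: xp; left.
have /holds1_neg : holds1 SM x (lformula_neg psi); last exact.
apply: xp; right; exists psi => //; split=> //.
exact/(interior0_basicP topM).
Qed.

(** The type of [a] over [B] is realized outside the closure of the union. A finite part of it
    defines a set over [B] that contains [a]; with empty interior, this set would put [a] in
    [Zcl SM B]. *)
Lemma Zcl_existence (kappa : Type) : saturated kappa SM ->
  infinite_set [set: kappa] -> existence kappa SM (Zcl SM).
Proof.
move=> satM kinf a B C Bs Cs na.
pose p : set (lformula L M 1) := [set psi | Defs.over B psi /\ holds1 SM a psi].
have [|q qp qfin|x [xp xBC]] := Zcl_realize satM (small_setU kinf Bs Cs) (p := p).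
- by move=> psi [Bpsi _] i; left; exact: Bpsi.
- apply: contrapT => nq; apply: na.
  exists [set x | forall psi, q psi -> holds1 SM x psi]; split.
  + apply: definable1_over_bigcap => // psi /qp [Bpsi _]; by exists psi.
  + exact/(interior0_basicP topM).
  + by move=> psi /qp [].
exists x; split=> // psi Bpsi; split=> [apsi|xpsi]; first exact: xp.
apply: contrapT => napsi; have /holds1_neg : holds1 SM x (lformula_neg psi); last exact.
by apply: xp; split=> //; apply/holds1_neg.
Qed.

(** Realizing the empty type gives a point outside the closure of the empty set. *)
Lemma Zcl_nontrivial (kappa : Type) : saturated kappa SM ->
  infinite_set [set: kappa] -> Zcl SM <> @trivial_matroid M.
Proof.
move=> satM kinf triv.
have small0 : small kappa (@set0 M).
  split; first exact: card_ge0.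
  by rewrite card_le0 => /eqP k0; apply: kinf; rewrite k0.
have [//|q q0 _|x [_]] := Zcl_realize satM small0 (p := set0).
  have [x0] := carrier_inhabited SM.
  have /(nbhs_basicP topM) [a [ax _]] : nbhs x0 setT by exact: filterT.
  by exists a; split; [exists x0|move=> x _ psi /q0].
by rewrite triv; apply.
Qed.

End Matroid.

Theorem theorem9p8 (L : language) (K M : topologicalType)
    (SK : structure L K) (SM : structure L M)
    (m : nat) (Phi : formula L m.+1) (f : K -> M) (kappa : Type)
    (topK : topologized_by SK Phi) (topM : topologized_by SM Phi)
    (monsterM : monster_model kappa SK SM f)
    (dminK : d_minimal SK SM) :
  existential_matroid kappa SM (Zcl SM).
Proof.
have elem := monster_elementary monsterM.
have satM := monster_saturated monsterM.
have kinf : infinite_set [set: kappa] by apply/infiniteP; case: (small_nat monsterM).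
split.
- exact: Zcl_matroid elem topK topM dminK.
- exact: Zcl_definable elem topK topM dminK.
- exact: Zcl_existence elem topK topM dminK _ satM kinf.
- exact: Zcl_nontrivial elem topK topM dminK _ satM kinf.
Qed.
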